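(* Let $m\in\mathbb{N}$, let $a\in\mathrm{R}_m$ be a regular residue modulo $m$, and let $k\in\mathbb{N}$. Then the congruence $x^k\equiv a \pmod m$ is solvable for $x\in\mathbb{Z}_m$ if and only if \[ a^{\frac{\omega_m(a)}{(k,\omega_m(a))}} \bmod m \in \mathrm{E}_m. \]
   Context: $\mathbb{N}=\{1,2,3,\dots\}$. For $m\in\mathbb{N}$, $\mathbb{Z}_m=\{1,\dots,m\}$, and $a \bmod m$ denotes the unique $b\in\mathbb{Z}_m$ with $a\equiv b\pmod m$. $(u,v)$ denotes the greatest common divisor. $\mathrm{E}_m=\{e\in\mathbb{Z}_m : e^2\equiv e \pmod m\}$ is the set of idempotent residues. For $a\in\mathbb{Z}$, the order $|a|_m$ is the smallest $n\in\mathbb{N}$ with $a^n \bmod m\in\mathrm{E}_m$ (it exists since $a^{\varphi(m)}\bmod m\in \mathrm{E}_m$). A residue $a\in\mathbb{Z}_m$ is regular if $a^{|a|_m+1}\equiv a\pmod m$; $\mathrm{R}_m$ is the set of regular residues. For $a,b\in\mathbb{Z}_m$, we say the index $\mathrm{ind}_b^m a$ exists if there is $n\in\mathbb{N}$ with $b^n\equiv a\pmod m$ (the index being the smallest such $n$). For $a\in\mathrm{R}_m$, the primitive order is $\omega_m(a)=\max\{|b|_m : b\in\mathrm{R}_m,\ \mathrm{ind}_b^m a \text{ exists}\}$. *)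

(* Defs.v *)
From mathcomp Require Import all_boot.

Set Implicit Arguments.
Unset Strict Implicit.
Unset Printing Implicit Defensive.

Definition residues (m : nat) : {pred nat} := [pred a | 0 < a <= m].

(* The representative of a modulo m in {1, ..., m}, whereas a %% m lies in
   {0, ..., m - 1}. *)
Definition resmod (a m : nat) : nat := if m %| a then m else a %% m.

Definition idempotents (m : nat) : {pred nat} :=
  [pred e | (e \in residues m) && (e ^ 2 == e %[mod m])].

Lemma resmod_mod a m : resmod a m = a %[mod m].
Proof.
by rewrite /resmod; case: ifP => [/eqP-> | _]; rewrite ?modnn ?modn_mod.
Qed.

Lemma resmod_residue a m : 0 < m -> resmod a m \in residues m.
Proof.
move=> m_gt0; rewrite /resmod inE; case: ifP => [_ | ndv].
  by rewrite m_gt0 leqnn.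
by rewrite lt0n [_ == _]ndv ltnW // ltn_pmod.
Qed.

Lemma expn_mod_period m b : 0 < m ->
  exists i p, [/\ 0 < i, 0 < p, i + p <= m.+1
    & forall n, i <= n -> b ^ (n + p) = b ^ n %[mod m]].
Proof.
move=> m_gt0; pose f (i : 'I_m.+1) := Ordinal (ltn_pmod (b ^ i.+1) m_gt0).
have /injectivePn [i [j ne_ij eq_f]] : ~~ injectiveb f.
  by apply/injectiveP => /leq_card; rewrite !card_ord ltnn.
have eqm : b ^ i.+1 = b ^ j.+1 %[mod m] by have := congr1 val eq_f.
wlog lt_ij : i j ne_ij eqm {eq_f} / i < j => [IH|].
  case: (ltngtP i j) => [lt|lt|eq]; first exact: (IH i j).
    by apply: (IH j i) => //; rewrite eq_sym.
  by case/eqP: ne_ij; apply: val_inj.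
exists i.+1, (j - i); split=> [||| n le_in] //; first by rewrite subn_gt0.
  by rewrite addSn subnKC ?(ltnW lt_ij).
rewrite -{1}(subnK le_in) -addnA addSn subnKC ?(ltnW lt_ij) //.
by rewrite expnD -modnMmr -eqm modnMmr -expnD subnK.
Qed.

Lemma expn_mod_idem m a : 0 < m ->
  exists n, (0 < n) && (resmod (a ^ n) m \in idempotents m).
Proof.
move=> m_gt0; have [i [p [i_gt0 p_gt0 _ per]]] := expn_mod_period a m_gt0.
have step t q : i <= t -> a ^ (t + q * p) = a ^ t %[mod m].
  move=> le_it; elim: q => [|q IHq]; first by rewrite mul0n addn0.
  by rewrite mulSn [p + _]addnC addnA per // (leq_trans le_it) ?leq_addr.
exists (i * p); rewrite muln_gt0 i_gt0 p_gt0 inE resmod_residue //=.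
rewrite -modnXm resmod_mod modnXm -expnM muln2 -addnn.
by apply/eqP/step; rewrite leq_pmulr.
Qed.

(* The order |a|_m; the value at m = 0, where there are no residues, is
   irrelevant. *)
Definition mod_order (m a : nat) : nat :=
  match @idP (0 < m) with
  | ReflectT m_gt0 => ex_minn (expn_mod_idem a m_gt0)
  | ReflectF _ => 0
  end.

Lemma mod_orderP m a : 0 < m ->
  [/\ 0 < mod_order m a, resmod (a ^ mod_order m a) m \in idempotents m
    & forall n, 0 < n -> resmod (a ^ n) m \in idempotents m ->
        mod_order m a <= n].
Proof.
rewrite /mod_order; case: {-}_ / idP => // m_gt0 _.
case: ex_minnP => n /andP[n_gt0 n_idem] n_min; split=> // n' n'_gt0 n'_idem.
by apply: n_min; rewrite n'_gt0.
Qed.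

Definition regular (m : nat) : {pred nat} :=
  [pred a | (a \in residues m) && (a ^ (mod_order m a).+1 == a %[mod m])].

Definition index_exists (m b a : nat) : Prop :=
  exists2 n, 0 < n & b ^ n = a %[mod m].

Lemma index_exists_dec m b a : decidable (index_exists m b a).
Proof.
pose P := [exists n : 'I_(m + a).+2, (0 < n) && (b ^ n == a %[mod m])].
apply: (@decP _ P); apply: (iffP existsP) => [[n /andP[n_gt0 /eqP]] | [n n_gt0 eqn]].
  by exists n.
have ex_n : exists n, (0 < n) && (b ^ n == a %[mod m]).
  by exists n; rewrite n_gt0; apply/eqP.
case: (ex_minnP ex_n) => {n_gt0 eqn}n /andP[n_gt0 /eqP eqn] n_min.
suff lt_n : n < (m + a).+2 by exists (Ordinal lt_n); rewrite /= n_gt0; apply/eqP.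
have [m0 | m_gt0] := posnP m.
  move: eqn n_min; rewrite m0 !modn0 => eqn n_min; case: (ltnP 1 b) => [b_gt1 | b_le1].
    by rewrite -eqn add0n (ltn_trans (ltn_expl n b_gt1)) // ltnS.
  suff n_le1 : n <= 1 by rewrite (leq_ltn_trans n_le1).
  apply: n_min; rewrite /= !modn0 expn1 -eqn.
  have [-> | ->] : b = 0 \/ b = 1 by case: (b) b_le1 => [|[|]]; auto.
    by rewrite exp0n.
  by rewrite exp1n.
have [i [p [i_gt0 p_gt0 le_ip per]]] := expn_mod_period b m_gt0.
rewrite ltnNge; apply/negP => lt_n.
have le_n : i + p <= n.
  by rewrite (leq_trans le_ip) // (leq_trans _ (ltnW lt_n)) // ltnS leq_addr.
suff : n <= n - p by rewrite leqNgt ltn_subrL p_gt0 n_gt0.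
have le_pn : p <= n by apply: leq_trans le_n; apply: leq_addl.
have le_in : i <= n - p by rewrite leq_subRL // addnC.
by apply: n_min; rewrite (leq_trans i_gt0 le_in) -eqn -(per _ le_in) subnK /=.
Qed.

(* For a regular, the maximum is over a nonempty set: b = a qualifies. *)
Definition primitive_order (m a : nat) : nat :=
  \max_(1 <= b < m.+1 | (b \in regular m) && index_exists_dec m b a)
    mod_order m b.

(* Main.v *)
(** The regular residues whose powers contain a given idempotent form a finite
abelian group, namely the units modulo n = m / (a, m), lifted to multiples of
(a, m) by the Chinese remainder theorem. In a finite abelian group the orders
of the cyclic subgroups containing a all divide the largest one w: if <b> and
<c> contain a, taking at each prime the primary component of b or of c,
whichever has the larger order, yields an element d such that <d> contains a
and the order of d is a multiple of both orders. If x ^ k = a then the order of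
x divides w, which divides k (w / (k, w)). Conversely, write a = b ^ i with b of
order w; the condition says that (k, w) divides i, so b ^ i is a k-th power. *)

Require Import Defs.
From mathcomp Require Import all_boot.
From mathcomp Require Import ssralg finalg zmodp fingroup cyclic pgroup.

Set Implicit Arguments.
Unset Strict Implicit.
Unset Printing Implicit Defensive.

(** * Roots in a finite abelian group *)

Lemma partn_dvd_logn (pi : nat_pred) n m : 0 < n -> 0 < m ->
  (forall p, p \in pi -> logn p n <= logn p m) -> n`_pi %| m`_pi.
Proof.
move=> n_gt0 m_gt0 le_log; apply/dvdn_partP => [|p]; first exact: part_gt0.
rewrite pi_of_part // inE => /andP[_ pi_p].
rewrite partn_part => [|q]; last by rewrite inE => /eqP->.
rewrite p_part (dvdn_trans (dvdn_exp2l _ (le_log p pi_p))) // -p_part.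
by rewrite -(@partn_part p pi) ?dvdn_part // => q; rewrite inE => /eqP->.
Qed.

Section AbelianRoots.

Local Open Scope group_scope.

Variables (gT : finGroupType) (G : {group gT}).
Hypothesis abG : abelian G.

Lemma cycle_common_multiple a b c : b \in G -> c \in G ->
    a \in <[b]> -> a \in <[c]> ->
  exists d, [/\ d \in G, a \in <[d]>, #[b] %| #[d] & #[c] %| #[d]].
Proof.
move=> Gb Gc /cycleP[i def_a] /cycleP[j def_a'].
pose pi : nat_pred := [pred p | logn p #[c] <= logn p #[b]].
have Gb' : b.`_pi \in G by apply: groupX.
have Gc' : c.`_pi^' \in G by apply: groupX.
have cbc : commute b.`_pi c.`_pi^' by apply: (centsP abG).
have co_bc : coprime #[b.`_pi] #[c.`_pi^'].
  by rewrite !order_constt coprime_partC.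
have bpart n : (n %| #[b.`_pi] * #[c.`_pi^']) = (n %| #[b]`_pi * #[c]`_pi^').
  by rewrite !order_constt.
exists (b.`_pi * c.`_pi^'); rewrite orderM // !bpart; split.
- exact: groupM.
(* The [pi]-part of [a] is a power of that of [b], its [pi^']-part a power of that of [c]; the
   orders being coprime, the cycle of the product contains both. *)
- rewrite cycleM // -(consttC pi a) mem_mulg //.
    by rewrite def_a consttX mem_cycle.
  by rewrite def_a' consttX mem_cycle.
- rewrite -{1}(partnC pi (order_gt0 b)) dvdn_mul // partn_dvd_logn // => p.
  by rewrite !inE -ltnNge; apply: ltnW.
- by rewrite -{1}(partnC pi (order_gt0 c)) dvdn_mul // partn_dvd_logn.
Qed.

Lemma abelian_rootP a k : a \in G -> (0 < k)%N ->
  let w := (\max_(b in G | a \in <[b]>) #[b])%N in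
  (exists2 x, x \in G & x ^+ k = a) <-> a ^+ (w %/ gcdn k w) = 1.
Proof.
move=> Ga k_gt0 w.
have [b /andP[Gb ab] def_w] :
    {b | b \in [pred b in G | a \in <[b]>] & w = #[b]}.
  apply: eq_bigmax_cond; apply/card_gt0P; exists a.
  by rewrite !inE Ga cycle_id.
have w_gt0 : (0 < w)%N by rewrite def_w order_gt0.
have g_gt0 : (0 < gcdn k w)%N by rewrite gcdn_gt0 k_gt0.
split=> [[x Gx def_a] | /eqP].
  have ax : a \in <[x]> by rewrite -def_a mem_cycle.
  (* [w = #[b]] divides [#[d]], so maximality of [w] forces [#[d] = w]. *)
  have [d [Gd ad dvd_bd dvd_xd]] := cycle_common_multiple Gb Gx ab ax.
  have le_dw : (#[d] <= w)%N by apply: leq_bigmax_cond; rewrite Gd ad.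
  have dvd_xw : #[x] %| w.
    suff -> : w = #[d] by [].
    by apply/eqP; rewrite eqn_leq le_dw andbT def_w dvdn_leq.
  apply/eqP; rewrite -def_a -expgM -order_dvdn (dvdn_trans dvd_xw) //.
  by rewrite muln_divCA_gcd dvdn_mulr.
case/cycleP: ab => i ->.
rewrite -expgM -order_dvdn -def_w -{1}(divnK (dvdn_gcdr k w)) mulnC.
have q_gt0 : (0 < w %/ gcdn k w)%N by rewrite divn_gt0 // dvdn_leq ?dvdn_gcdr.
rewrite dvdn_pmul2r // => /dvdnP[q ->].
(* Bezout: [u * k = v * w + gcdn k w], and the term [v * w] is killed by [b ^+ w = 1]. *)
have [u v def_g _] := egcdnP w k_gt0.
exists (b ^+ (u * q)); first exact: groupX.
have bv1 : b ^+ (v * w * q) = 1.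
  by apply/eqP; rewrite -order_dvdn -def_w mulnAC dvdn_mull.
by rewrite -expgM mulnAC def_g mulnDl expgD bv1 mul1g mulnC.
Qed.

End AbelianRoots.

(** * Units modulo [n] represented by natural numbers *)

Section ZpUnits.

Local Open Scope group_scope.

(* The junk value at a b not coprime to n is 1. *)
Definition Zp_unit (n b : nat) : {unit 'Z_n} :=
  insubd (1 : {unit 'Z_n}) (b%:R : 'Z_n)%R.

Variable n : nat.
Hypothesis n_gt1 : (1 < n)%N.

Lemma val_Zp_unit b : coprime n b -> val (Zp_unit n b) = (b%:R)%R.
Proof. by move=> co_nb; rewrite val_insubd unitZpE ?co_nb. Qed.

Lemma Zp_unitX_eq b c j : coprime n b -> coprime n c ->
  (Zp_unit n b ^+ j == Zp_unit n c) = (b ^ j == c %[mod n])%N.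
Proof.
move=> co_nb co_nc; rewrite -val_eqE FinRing.val_unitX !val_Zp_unit //.
by rewrite -GRing.natrX -(inj_eq (@ord_inj _)) !val_Zp_nat.
Qed.

Lemma Zp_unitX_eq1 b j : coprime n b ->
  (Zp_unit n b ^+ j == 1) = (b ^ j == 1 %[mod n])%N.
Proof.
move=> co_nb; rewrite -Zp_unitX_eq ?coprimen1 //.
by congr (_ == _); apply: val_inj; rewrite val_Zp_unit ?coprimen1.
Qed.

Lemma Zp_unit_lift (u : {unit 'Z_n}) :
  exists2 b, coprime n b & Zp_unit n b = u.
Proof.
have val_u : ((val u : 'Z_n)%:R)%R = val u by rewrite natr_Zp.
have co_nu : coprime n (val u : 'Z_n).
  by rewrite -unitZpE // val_u; apply: valP.
by exists (val u : 'Z_n) => //; apply: val_inj; rewrite val_Zp_unit.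
Qed.

End ZpUnits.

(** * Regular residues as units modulo a coprime factor *)

Lemma regular_gcd_coprime m a : 0 < m -> a \in regular m ->
  coprime (m %/ gcdn a m) a.
Proof.
move=> m_gt0 /andP[/andP[a_gt0 _] /eqP a_per].
have [w_gt0 _ _] := mod_orderP a m_gt0; move: a_per w_gt0.
move: (mod_order m a) => w a_per w_gt0.
have g_gt0 : 0 < gcdn a m by rewrite gcdn_gt0 a_gt0.
have le_a : a <= a ^ w.+1 by rewrite -{1}[a]expn1 leq_pexp2l.
have aw_gt0 : 0 < a ^ w by rewrite expn_gt0 a_gt0.
have co_g : coprime (m %/ gcdn a m) (a %/ gcdn a m).
  rewrite /coprime -(eqn_pmul2r g_gt0) muln_gcdl !divnK ?dvdn_gcdl ?dvdn_gcdr //.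
  by rewrite mul1n gcdnC.
(* Regularity says that [m] divides [a * (a ^ w - 1)]. Cancelling the gcd, then the cofactor of [a],
   which is coprime to that of [m], makes [a] invertible modulo [m %/ gcdn a m]. *)
have : m %/ gcdn a m * gcdn a m %| a %/ gcdn a m * gcdn a m * (a ^ w - 1).
  rewrite !divnK ?dvdn_gcdl ?dvdn_gcdr // mulnBr muln1 -expnS.
  by rewrite -eqn_mod_dvd // a_per.
rewrite mulnAC dvdn_pmul2r // Gauss_dvdr //.
rewrite -eqn_mod_dvd // => /eqP aw1.
by rewrite -(coprime_pexpr _ _ w_gt0) -coprime_modr aw1 coprime_modr coprimen1.
Qed.

Section CoprimeProduct.

Variables d n : nat.
Hypotheses (co_dn : coprime d n) (dn_gt0 : 0 < d * n).

Lemma eqmodM_dvd a b : d %| a -> d %| b ->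
  (a == b %[mod d * n]) = (a == b %[mod n]).
Proof.
move=> /eqP da /eqP db; rewrite chinese_remainder //.
by rewrite da db eqxx.
Qed.

(** Modulo [d] the positive powers of [b] vanish; modulo [n] they are units, and the only idempotent
    unit is 1. *)
Lemma idempotent_expn b j : d %| b -> coprime n b -> 0 < j ->
  (resmod (b ^ j) (d * n) \in idempotents (d * n)) = (b ^ j == 1 %[mod n]).
Proof.
move=> db co_nb j_gt0; rewrite inE resmod_residue //=.
rewrite -modnXm resmod_mod modnXm eqmodM_dvd ?dvdn_exp //.
have [b0 | b_gt0] := posnP b.
  move: co_nb; rewrite b0 /coprime gcdn0 => /eqP->.
  by rewrite !modn1.
have bj_gt0 : 0 < b ^ j by rewrite expn_gt0 b_gt0.
rewrite eqn_mod_dvd ?eqn_mod_dvd // ?leq_pexp2l //; last first.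
  by rewrite -{1}[b ^ j]expn1 leq_pexp2l.
by rewrite expnS expn1 -{3}[b ^ j]muln1 -mulnBr Gauss_dvdr // coprimeXr.
Qed.

Lemma residue_lift b : coprime n b ->
  exists c, [/\ c \in residues (d * n), d %| c, coprime n c & c = b %[mod n]].
Proof.
move=> co_nb; pose c := resmod (chinese d n 0 b) (d * n).
have eq_c : c = chinese d n 0 b %[mod d * n] by apply: resmod_mod.
have cn : c = b %[mod n].
  rewrite -(modn_dvdm c (dvdn_mull d (dvdnn n))) eq_c modn_dvdm ?dvdn_mull //.
  by rewrite chinese_modr.
exists c; split=> //; first exact: resmod_residue.
  rewrite /dvdn -(modn_dvdm c (dvdn_mulr n (dvdnn d))) eq_c.
  by rewrite modn_dvdm ?dvdn_mulr // chinese_modl // mod0n.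
by rewrite -coprime_modr cn coprime_modr.
Qed.

Lemma regular_unit b : b \in residues (d * n) -> d %| b -> coprime n b ->
  b \in regular (d * n).
Proof.
move=> res_b db co_nb; rewrite inE res_b /=.
have [w_gt0 + _] := mod_orderP b dn_gt0.
rewrite idempotent_expn // => /eqP bw1.
by rewrite eqmodM_dvd ?dvdn_exp // expnS -modnMmr bw1 modnMmr muln1.
Qed.

Lemma mod_order_unit b : 1 < n -> d %| b -> coprime n b ->
  mod_order (d * n) b = #[Zp_unit n b]%g.
Proof.
move=> n_gt1 db co_nb; have [w_gt0 w_idem w_min] := mod_orderP b dn_gt0.
apply/eqP; rewrite eqn_leq w_min ?order_gt0 ?idempotent_expn ?order_gt0 //=.
  apply: dvdn_leq => //; rewrite order_dvdn Zp_unitX_eq1 //.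
  by rewrite -idempotent_expn.
by rewrite -Zp_unitX_eq1 // expg_order.
Qed.

(** By regularity [b] is congruent to arbitrarily high powers of itself, hence to a multiple of a
    power [b ^ j] congruent to [a]; and [d] divides the modulus. *)
Lemma regular_root_dvd a b : d %| a -> b \in regular (d * n) ->
  index_exists (d * n) b a -> d %| b.
Proof.
move=> da /andP[_ /eqP b_per] [j j_gt0 def_a].
have [w_gt0 _ _] := mod_orderP b dn_gt0; move: b_per w_gt0.
move: (mod_order _ b) => w b_per w_gt0.
have per t : b ^ (t * w).+1 = b %[mod d * n].
  elim: t => // t IHt; rewrite mulSn addnC -addSn expnD -modnMml IHt modnMml.
  by rewrite -expnS.
have dvd_d x y : x = y %[mod d * n] -> (d %| x) = (d %| y).
  move=> eq_xy; rewrite /dvdn -(modn_dvdm x (dvdn_mulr n (dvdnn d))) eq_xy.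
  by rewrite modn_dvdm // dvdn_mulr.
rewrite -(dvd_d _ _ (per j)); apply: dvdn_trans (dvdn_exp2l b (_ : j <= _)).
  by rewrite (dvd_d _ _ def_a).
by apply: leqW; rewrite leq_pmulr.
Qed.

Lemma root_coprime a b j : coprime n a -> 0 < j -> b ^ j = a %[mod d * n] ->
  coprime n b.
Proof.
move=> co_na j_gt0 def_a; rewrite -(coprime_pexpr _ _ j_gt0) -coprime_modr.
rewrite -(modn_dvdm _ (dvdn_mull d (dvdnn n))) def_a modn_dvdm ?dvdn_mull //.
by rewrite coprime_modr.
Qed.

Lemma index_exists_unit a b : 1 < n -> d %| a -> coprime n a ->
    d %| b -> coprime n b ->
  index_exists (d * n) b a <-> Zp_unit n a \in <[Zp_unit n b]>%g.
Proof.
move=> n_gt1 da co_na db co_nb; split=> [[j j_gt0 /eqP]|].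
  rewrite eqmodM_dvd ?dvdn_exp // -Zp_unitX_eq // => /eqP <-.
  exact: mem_cycle.
(* Here [i] may be 0, whereas an index is positive; adding the order of the unit repairs this. *)
case/cycleP=> i def_a; exists (i + #[Zp_unit n b]%g).
  by rewrite ltn_addl.
apply/eqP; rewrite eqmodM_dvd ?dvdn_exp ?ltn_addl // -Zp_unitX_eq //.
by rewrite expgD expg_order mulg1 def_a.
Qed.

(** This turns the maximum over residues into the [w] of [abelian_rootP]: a regular [b] with [a]
    among its powers is a multiple of [d] coprime to [n], and every unit lifts to a regular multiple
    of [d]. *)
Lemma primitive_order_unit a : 1 < n -> d %| a -> coprime n a ->
  primitive_order (d * n) a =
    \max_(u in [set: {unit 'Z_n}] | Zp_unit n a \in <[u]>%g) #[u]%g.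
Proof.
move=> n_gt1 da co_na; apply/eqP; rewrite eqn_leq; apply/andP; split.
  rewrite /primitive_order big_seq_cond.
  apply/bigmax_leqP_seq => b _ /and3P[_ reg_b /sumboolP ind_b].
  have db := regular_root_dvd da reg_b ind_b.
  have [j j_gt0 /(root_coprime co_na j_gt0) co_nb] := ind_b.
  rewrite mod_order_unit //; apply: leq_bigmax_cond.
  by rewrite inE; apply/index_exists_unit.
apply/bigmax_leqP => u /andP[_ au].
have [b0 co_nb0 def_u] := Zp_unit_lift n_gt1 u.
have [b [res_b db co_nb eq_b]] := residue_lift co_nb0.
have {}def_u : Zp_unit n b = u.
  by apply/eqP; rewrite -def_u -[Zp_unit n b]expg1 Zp_unitX_eq // expn1; apply/eqP.
rewrite -def_u -mod_order_unit // /primitive_order.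
apply: (@leq_bigmax_seq _ _ _ (mod_order (d * n)) b).
  by rewrite mem_index_iota.
by rewrite regular_unit //; apply/sumboolP/index_exists_unit; rewrite ?def_u.
Qed.

(** A root [x] need be neither regular nor a multiple of [d], but its class modulo [n] is a unit;
    conversely, a root among the units lifts to a multiple of [d]. *)
Lemma root_unit a k : 1 < n -> d %| a -> coprime n a -> 0 < k ->
  (exists2 x, x \in residues (d * n) & x ^ k = a %[mod d * n]) <->
  (exists2 u, u \in [set: {unit 'Z_n}] & u ^+ k = Zp_unit n a)%g.
Proof.
move=> n_gt1 da co_na k_gt0; split=> [[x _ def_a] | [u _ def_a]].
  have co_nx := root_coprime co_na k_gt0 def_a.
  exists (Zp_unit n x) => //; apply/eqP; rewrite Zp_unitX_eq //; apply/eqP.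
  rewrite -(modn_dvdm _ (dvdn_mull d (dvdnn n))) def_a.
  by rewrite modn_dvdm ?dvdn_mull.
have [b0 co_nb0 def_u] := Zp_unit_lift n_gt1 u.
have [b [res_b db co_nb eq_b]] := residue_lift co_nb0.
exists b => //; apply/eqP; rewrite eqmodM_dvd ?dvdn_exp //.
by rewrite -modnXm eq_b modnXm -Zp_unitX_eq // def_u def_a.
Qed.

End CoprimeProduct.

(** * The criterion carried back to residues *)

Theorem theorem3p2 (m a k : nat) (m_gt0 : 0 < m) (a_reg : a \in regular m)
    (k_gt0 : 0 < k) :
  (exists2 x, x \in residues m & x ^ k = a %[mod m]) <->
  resmod (a ^ (primitive_order m a %/ gcdn k (primitive_order m a))) m
    \in idempotents m.
Proof.
have co_na := regular_gcd_coprime m_gt0 a_reg.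
pose d := gcdn a m; pose n := m %/ d.
have def_m : m = d * n by rewrite mulnC divnK ?dvdn_gcdr.
have da : d %| a by apply: dvdn_gcdl.
have co_dn : coprime d n by rewrite coprime_sym (coprime_dvdr da).
have dn_gt0 : 0 < d * n by rewrite -def_m.
(* 'Z_1 is the integers mod 2, so n = 1 cannot be handled through {unit 'Z_n}. *)
have [n_gt1 | n_le1] := ltnP 1 n; last first.
  have /eqP am : m %| a.
    have n1 : n = 1.
      by apply/eqP; rewrite eqn_leq n_le1; case: (n) dn_gt0; rewrite ?muln0.
    by rewrite def_m n1 muln1.
  have mod_aX j : 0 < j -> a ^ j = 0 %[mod m].
    by move=> j_gt0; rewrite -modnXm am exp0n // mod0n.
  (* Both sides hold: [m] is a root, and the power of [a] is 0 or, for exponent 0, 1 modulo [m]. *)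
  split=> _; last first.
    by exists m; rewrite ?inE ?m_gt0 //= -modnXm modnn exp0n // am mod0n.
  rewrite inE resmod_residue //= -modnXm resmod_mod modnXm.
  by case: (_ %/ _) => [|j]; rewrite ?exp1n // -modnXm mod_aX // modnXm exp0n.
have Ga : Zp_unit n a \in [set: {unit 'Z_n}] by rewrite inE.
rewrite def_m primitive_order_unit //.
apply: (iff_trans (root_unit co_dn dn_gt0 n_gt1 da co_na k_gt0)).
apply: (iff_trans (abelian_rootP (units_Zp_abelian n) Ga k_gt0)).
set w := \max_(u in _ | _) _.
(* [idempotent_expn] needs a positive exponent; [w] is at least the order of the unit of [a]. *)
have w_gt0 : 0 < w.
  apply: leq_trans (order_gt0 (Zp_unit n a)) (leq_bigmax_cond _ _).
  by rewrite Ga cycle_id.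
rewrite idempotent_expn //; last first.
  by rewrite divn_gt0 ?gcdn_gt0 ?k_gt0 // dvdn_leq ?dvdn_gcdr.
by rewrite -Zp_unitX_eq1 //; split=> /eqP.
Qed.
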